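(* For each positive integer $n$ let $c_i$ ($i\in\{0,\dots,n-1\}$) be the arc-bits and $b_i$ ($i\in\{0,\dots,n-1\}$) their half-chord approximations, as defined in the context (both depend on $n$). Let $$\hat{A}=\lim_{n\to\infty}\sum_{i=0}^{n-1}b_i,\qquad \overset{\frown}{C}=\lim_{n\to\infty}\sum_{i=0}^{n-1}c_i .$$ Then $\overset{\frown}{C}=\hat{A}$.
   Context: Consider a circle of radius $1$ with center $O$, and let $OEAS$ be a square of side $1$ that is a quadrant of the square circumscribing the circle, so that $E$ lies on the circle and the side $EA$ (of length $1$) is tangent to the circle at $E$. For a positive integer $n$, divide the segment $EA$ into $n$ equal parts by equidistant points $E=A_0,A_1,\dots,A_n=A$, so each part has length $\frac1n$. For $i\in\{0,\dots,n\}$ let $C_i$ be the point where the segment $OA_i$ meets the circle (so $C_0=A_0=E$). For $i\in\{0,\dots,n-1\}$: the arc-bit $c_i$ is the length of the (short) circular arc from $C_i$ to $C_{i+1}$; let $Q_i$ be the foot of the perpendicular dropped from $C_i$ to $OA_{i+1}$; the half-chord approximation $b_i$ is the length of the segment $C_iQ_i$. *)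

(* Defs.v *)
From Stdlib Require Import Reals.
From Coquelicot Require Import Coquelicot.

(* The Euclidean plane is Coquelicot's [C], with
   distance [Cmod (Y - X)]. *)

Open Scope R_scope.

Definition dist2 (X Y : C) : R := Cmod (Y - X)%C.

Definition dot (u v : C) : R := Re u * Re v + Im u * Im v.

Definition on_circle (O : C) (r : R) (X : C) : Prop := dist2 O X = r.

Definition on_line (X Y Z : C) : Prop :=
  exists t : R, Z = (X + RtoC t * (Y - X))%C.

Definition on_segment (X Y Z : C) : Prop :=
  exists t : R, 0 <= t <= 1 /\ Z = (X + RtoC t * (Y - X))%C.

(* The vertices are listed in cyclic order: a parallelogram with two equal
   adjacent sides and a right angle.  When [W] is the centre of a circle of
   radius [l], such a square is automatically a quadrant of a circumscribing
   square: [X] and [Z] lie on the circle and [XY] is tangent to it at [X]. *)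
Definition is_square (l : R) (W X Y Z : C) : Prop :=
  dist2 W X = l /\ dist2 X Y = l /\
  dot (X - W)%C (Y - X)%C = 0 /\ (Z - W)%C = (Y - X)%C.

Definition division_point (X Y : C) (n i : nat) : C :=
  (X + RtoC (INR i / INR n) * (Y - X))%C.

Definition is_foot (X Y Z F : C) : Prop :=
  on_line Y Z F /\ dot (F - X)%C (Z - Y)%C = 0.

Definition inscribed_polygon_length (g : R -> C) (a b l : R) : Prop :=
  exists (m : nat) (t : nat -> R),
    t 0%nat = a /\ t (S m) = b /\
    (forall k : nat, (k <= m)%nat -> t k <= t (S k)) /\
    l = sum_n (fun k => dist2 (g (t k)) (g (t (S k)))) m.

Definition curve_length (g : R -> C) (a b : R) : Rbar :=
  Lub_Rbar (inscribed_polygon_length g a b).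

(* For non-antipodal [X], [Y] on the circle with centre [O] and radius [r],
   the central projection of the chord [XY] onto the circle runs once and
   monotonically, for [t] in [0,1], through the shorter arc from [X] to [Y]. *)
Definition short_arc (O : C) (r : R) (X Y : C) (t : R) : C :=
  let Z := (X + RtoC t * (Y - X))%C in
  (O + RtoC (r / dist2 O Z) * (Z - O))%C.

Definition short_arc_length (O : C) (r : R) (X Y : C) : R :=
  real (curve_length (short_arc O r X Y) 0 1).

(* Main.v *)
Require Import Defs.
From Stdlib Require Import Reals.
From Coquelicot Require Import Coquelicot.
From Stdlib Require Import Lra Lia.
Open Scope R_scope.

(** In the orthonormal frame [u = E - O], [v = A - E], the division point [A_i]
    is [O + (u + x_i v)] with [x_i = i / n], so [C_i] is the point of the unit
    circle at angle [atan x_i].  Four facts hold for each [i]: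

    - [b_i <= c_i]: the foot [Q_i] is the point of the line [O A_{i+1}] nearest to
      [C_i] ([foot_nearest]), and [C_{i+1}] lies on that line, so [b_i] is at most
      the chord [C_i C_{i+1}], which is an inscribed polygon of the arc;
    - [c_i <= atan x_{i+1} - atan x_i]: along the arc the angle increases, and a
      chord is at most the angle it subtends, so the length of an inscribed
      polygon is at most the total angle ([short_arc_length_bounds]);
    - [b_i >= (1/n) / (1 + x_{i+1}^2)], from the coordinates of the foot
      ([foot_distance_ge]);
    - [atan x_{i+1} - atan x_i <= (1/n) / (1 + x_i^2)], by the mean value theorem
      ([atan_increment_le]).

    The left and right Riemann sums of [1 / (1 + x^2)] on [0,1] differ by
    [1/(2n)], so summing over [i] gives
    [atan 1 - 1/(2n) <= sum b_i <= sum c_i <= atan 1],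
    and both limits are [atan 1] by squeezing. *)

(** * Points of a unit circle in an orthonormal frame *)

(** For orthonormal [u], [v]: the point at angle [theta] of the unit circle with
    centre [O], angles being measured from [u] towards [v]. *)
Definition circle_point (O u v : C) (theta : R) : C :=
  (O + (RtoC (cos theta) * u + RtoC (sin theta) * v))%C.

(** The complex numbers [u] and [v] are orthonormal as vectors of the plane. *)
Definition orthonormal (u v : C) : Prop :=
  dot u u = 1 /\ dot v v = 1 /\ dot u v = 0.

Lemma dot_frame (u v : C) (a b c d : R) : orthonormal u v ->
  dot (RtoC a * u + RtoC b * v)%C (RtoC c * u + RtoC d * v)%C = a * c + b * d.
Proof.
  intros (Hu & Hv & Huv).
  transitivity (a * c * dot u u + b * d * dot v v + (a * d + b * c) * dot u v).
  - unfold dot; destruct u, v; simpl; ring.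
  - rewrite Hu, Hv, Huv; ring.
Qed.

Lemma Cmod_dot (z : C) : Cmod z = sqrt (dot z z).
Proof. unfold Cmod, dot; destruct z; simpl; f_equal; ring. Qed.

Lemma dot_self_ge0 (z : C) : 0 <= dot z z.
Proof. unfold dot; nra. Qed.

Lemma Cmod_frame (u v : C) (a b : R) : orthonormal u v ->
  Cmod (RtoC a * u + RtoC b * v)%C = sqrt (a * a + b * b).
Proof. intros H; now rewrite Cmod_dot, dot_frame. Qed.

(** A chord of the unit circle is at most the angle it subtends: its length is
    [2 |sin ((b - a) / 2)|]. *)
Lemma dist2_circle_point (O u v : C) (a b : R) : orthonormal u v ->
  a <= b -> dist2 (circle_point O u v a) (circle_point O u v b) <= b - a.
Proof.
  intros H Hab; unfold dist2, circle_point.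
  replace (O + (RtoC (cos b) * u + RtoC (sin b) * v) -
           (O + (RtoC (cos a) * u + RtoC (sin a) * v)))%C
    with (RtoC (cos b - cos a) * u + RtoC (sin b - sin a) * v)%C
    by (rewrite !RtoC_minus; ring).
  rewrite Cmod_frame by exact H.
  set (d := (b - a) / 2).
  assert (E : (cos b - cos a) * (cos b - cos a) + (sin b - sin a) * (sin b - sin a)
              = Rsqr (2 * sin d)).
  { replace b with ((a + d) + d) by (unfold d; field).
    replace (cos a) with (cos ((a + d) - d)) by (f_equal; ring).
    replace (sin a) with (sin ((a + d) - d)) by (f_equal; ring).
    rewrite (cos_plus (a + d)), (sin_plus (a + d)), cos_minus, sin_minus.
    assert (K := sin2_cos2 (a + d)); unfold Rsqr in *.
    transitivity (4 * (sin d * sin d) *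
      (sin (a + d) * sin (a + d) + cos (a + d) * cos (a + d))); [ring|].
    rewrite K; ring. }
  rewrite E, sqrt_Rsqr_abs, Rabs_mult, (Rabs_right 2) by lra.
  replace (b - a) with (2 * d) by (unfold d; field).
  apply Rmult_le_compat_l; [lra|].
  assert (Hd : 0 <= d) by (unfold d; lra).
  destruct (Req_dec d 0) as [->|Hd0]; [rewrite sin_0, Rabs_R0; lra|].
  (* [sin d >= - d]: if [d <= 1 < PI], then [sin d >= 0]; otherwise
     [sin d >= - 1 > - d]. *)
  apply Rabs_le; split.
  - destruct (Rle_dec d 1) as [Hd1|Hd1].
    + assert (0 <= sin d); [|lra].
      apply sin_ge_0; [exact Hd | assert (K := PI2_1); lra].
    + assert (K := SIN_bound d); lra.
  - left; apply sin_lt_x; lra.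
Qed.

(** The central projection of [O + (x u + y v)] onto the circle, for [x > 0], is
    the point at angle [atan (y / x)] when [u], [v] are orthonormal. *)
Lemma circle_point_direction (O u v : C) (x y : R) : 0 < x ->
  circle_point O u v (atan (y / x)) =
  (O + RtoC (1 / sqrt (x * x + y * y)) * (RtoC x * u + RtoC y * v))%C.
Proof.
  intros Hx; unfold circle_point; rewrite cos_atan, sin_atan.
  assert (Hn : 0 < sqrt (x * x + y * y)) by (apply sqrt_lt_R0; nra).
  replace (sqrt (1 + (y / x)²)) with (sqrt (x * x + y * y) / x).
  2:{ replace (1 + (y / x)²) with ((x * x + y * y) / (x * x))
        by (unfold Rsqr; field; lra).
      now rewrite sqrt_div_alt, sqrt_square by nra. }
  replace (1 / (sqrt (x * x + y * y) / x)) with (1 / sqrt (x * x + y * y) * x)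
    by (field; lra).
  replace (y / x / (sqrt (x * x + y * y) / x)) with (1 / sqrt (x * x + y * y) * y)
    by (field; lra).
  rewrite !RtoC_mult; ring.
Qed.

Lemma square_frame (O E A S : C) : is_square 1 O E A S ->
  orthonormal (E - O)%C (A - E)%C.
Proof.
  intros (H1 & H2 & H3 & _); unfold dist2 in *.
  rewrite Cmod_dot in H1, H2.
  repeat split; [| |exact H3].
  - rewrite <- (sqrt_sqrt (dot _ _)) by apply dot_self_ge0. rewrite H1; ring.
  - rewrite <- (sqrt_sqrt (dot _ _)) by apply dot_self_ge0. rewrite H2; ring.
Qed.

(** The point where the ray from [O] through [O + (u + x v)] meets the circle. *)
Lemma radial_point (O u v X : C) (x : R) : orthonormal u v ->
  on_segment O (O + (u + RtoC x * v))%C X -> on_circle O 1 X ->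
  X = circle_point O u v (atan x).
Proof.
  intros H [t [Ht ->]] Hcirc.
  replace x with (x / 1) at 2 by field.
  rewrite circle_point_direction by lra.
  unfold on_circle, dist2 in Hcirc.
  replace (O + RtoC t * (O + (u + RtoC x * v) - O) - O)%C
    with (RtoC t * (RtoC 1 * u + RtoC x * v))%C in Hcirc by ring.
  rewrite Cmod_mult, Cmod_R, Rabs_right, Cmod_frame in Hcirc by (trivial; lra).
  assert (Hn : 0 < sqrt (1 * 1 + x * x)) by (apply sqrt_lt_R0; nra).
  replace (1 / sqrt (1 * 1 + x * x)) with t
    by (apply Rmult_eq_reg_r with (sqrt (1 * 1 + x * x)); [rewrite Hcirc; field|]; lra).
  ring.
Qed.

Lemma radial_point_on_line (O u v : C) (x : R) :
  on_line O (O + (u + RtoC x * v))%C (circle_point O u v (atan x)).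
Proof.
  replace x with (x / 1) at 2 by field.
  rewrite circle_point_direction by lra.
  exists (1 / sqrt (1 * 1 + x * x)); ring.
Qed.

(** * Length of the short arc *)

Lemma sum_n_le_upto (a b : nat -> R) (N : nat) :
  (forall i, (i <= N)%nat -> a i <= b i) -> sum_n a N <= sum_n b N.
Proof. intros H; rewrite !sum_n_Reals; now apply sum_Rle. Qed.

Lemma sum_n_telescope (G : nat -> R) (N : nat) :
  sum_n (fun i => G (S i) - G i) N = G (S N) - G 0%nat.
Proof.
  induction N as [|N IH]; [now rewrite sum_O|].
  rewrite sum_Sn, IH; unfold plus; simpl; ring.
Qed.

(** If chords of [g] are bounded by the increments of [phi], so is the length of
    [g], which is then finite; it is never less than the chord of the endpoints. *)
Lemma curve_length_bounds (g : R -> C) (phi : R -> R) (a b : R) :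
  a <= b ->
  (forall s t, a <= s -> s <= t -> t <= b -> dist2 (g s) (g t) <= phi t - phi s) ->
  dist2 (g a) (g b) <= real (curve_length g a b) <= phi b - phi a.
Proof.
  intros Hab Hg; unfold curve_length.
  destruct (Lub_Rbar_correct (inscribed_polygon_length g a b)) as [Hub Hlub].
  assert (Hchord : inscribed_polygon_length g a b (dist2 (g a) (g b))).
  { exists 0%nat, (fun k => match k with 0%nat => a | _ => b end).
    repeat split.
    - intros [|k] _; lra.
    - now rewrite sum_O. }
  assert (Hbd : is_ub_Rbar (inscribed_polygon_length g a b) (phi b - phi a)).
  { intros l (m & t & H0 & H1 & Hmon & ->); simpl.
    (* The subdivision points lie in [a,b], by induction from either end. *)
    assert (Hlo : forall k, (k <= S m)%nat -> a <= t k).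
    { induction k as [|k IH]; intros Hk; [lra|].
      apply Rle_trans with (t k); [apply IH | apply Hmon]; lia. }
    assert (Hhi : forall k, (k <= S m)%nat -> t (S m - k)%nat <= b).
    { induction k as [|k IH]; intros Hk; [rewrite Nat.sub_0_r; lra|].
      apply Rle_trans with (t (S m - k)%nat); [|apply IH; lia].
      replace (S m - k)%nat with (S (S m - S k)) by lia.
      apply Hmon; lia. }
    rewrite <- H0, <- H1, <- (sum_n_telescope (fun k => phi (t k))).
    apply sum_n_le_upto; intros i Hi; apply Hg; [apply Hlo; lia | apply Hmon; lia |].
    replace (S i) with (S m - (m - i))%nat by lia; apply Hhi; lia. }
  assert (H1 := Hub _ Hchord); assert (H2 := Hlub _ Hbd).
  destruct (Lub_Rbar (inscribed_polygon_length g a b)); simpl in *;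
    [split; assumption | contradiction | contradiction].
Qed.

(** The angle under which the centre sees the point at parameter [t] of the chord
    from the point at angle [a] to the point at angle [b].  For [a], [b] strictly
    between [- PI / 2] and [PI / 2] and [t] in [0,1] the denominator is positive,
    so that [atan] gives the actual angle. *)
Definition chord_angle (a b t : R) : R :=
  atan (((1 - t) * sin a + t * sin b) / ((1 - t) * cos a + t * cos b)).

Lemma convex_comb_gt0 (x y t : R) : 0 < x -> 0 < y -> 0 <= t <= 1 ->
  0 < (1 - t) * x + t * y.
Proof.
  intros Hx Hy Ht.
  destruct (Req_dec t 0) as [->|Ht0]; [lra|].
  assert (0 < t * y) by (apply Rmult_lt_0_compat; lra).
  assert (0 <= (1 - t) * x) by (apply Rmult_le_pos; lra).
  lra.
Qed.

Lemma short_arc_circle_point (O u v : C) (a b t : R) : orthonormal u v ->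
  - PI / 2 < a < PI / 2 -> - PI / 2 < b < PI / 2 -> 0 <= t <= 1 ->
  short_arc O 1 (circle_point O u v a) (circle_point O u v b) t =
  circle_point O u v (chord_angle a b t).
Proof.
  intros H Ha Hb Ht.
  assert (Hc : 0 < (1 - t) * cos a + t * cos b)
    by (apply convex_comb_gt0; [apply cos_gt_0 | apply cos_gt_0 | ]; lra).
  unfold chord_angle; rewrite circle_point_direction by exact Hc.
  unfold short_arc, dist2.
  replace (circle_point O u v a + RtoC t * (circle_point O u v b - circle_point O u v a) - O)%C
    with (RtoC ((1 - t) * cos a + t * cos b) * u + RtoC ((1 - t) * sin a + t * sin b) * v)%C
    by (unfold circle_point; rewrite !RtoC_plus, !RtoC_mult, !RtoC_minus; ring).
  now rewrite Cmod_frame.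
Qed.

Lemma chord_angle_incr (a b s t : R) :
  - PI / 2 < a -> a <= b -> b < PI / 2 -> 0 <= s -> s <= t -> t <= 1 ->
  chord_angle a b s <= chord_angle a b t.
Proof.
  intros Ha Hab Hb Hs Hst Ht; unfold chord_angle.
  assert (Hca : 0 < cos a) by (apply cos_gt_0; lra).
  assert (Hcb : 0 < cos b) by (apply cos_gt_0; lra).
  assert (Ps := convex_comb_gt0 _ _ s Hca Hcb ltac:(lra)).
  assert (Pt := convex_comb_gt0 _ _ t Hca Hcb ltac:(lra)).
  assert (Hsin : 0 <= sin (b - a)) by (apply sin_ge_0; lra).
  rewrite sin_minus in Hsin.
  match goal with |- atan ?p <= atan ?q => assert (K : p <= q) end.
  { apply Rminus_le_0.
    (* The cross product of the two directions is [(t - s) sin (b - a)]. *)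
    match goal with |- 0 <= ?y / ?x - ?y' / ?x' =>
      replace (y / x - y' / x') with
        ((t - s) * (sin b * cos a - cos b * sin a) / (x * x')) by (field; lra) end.
    apply Rdiv_le_0_compat; [apply Rmult_le_pos; lra | apply Rmult_lt_0_compat; lra]. }
  destruct K as [K | ->]; [left; now apply atan_increasing | lra].
Qed.

Lemma short_arc_length_bounds (O u v : C) (a b : R) : orthonormal u v ->
  - PI / 2 < a -> a <= b -> b < PI / 2 ->
  dist2 (circle_point O u v a) (circle_point O u v b) <=
  short_arc_length O 1 (circle_point O u v a) (circle_point O u v b) <= b - a.
Proof.
  intros H Ha Hab Hb; unfold short_arc_length.
  assert (E0 : chord_angle a b 0 = a).
  { unfold chord_angle.
    replace ((1 - 0) * sin a + 0 * sin b) with (sin a) by ring.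
    replace ((1 - 0) * cos a + 0 * cos b) with (cos a) by ring.
    apply atan_tan; lra. }
  assert (E1 : chord_angle a b 1 = b).
  { unfold chord_angle.
    replace ((1 - 1) * sin a + 1 * sin b) with (sin b) by ring.
    replace ((1 - 1) * cos a + 1 * cos b) with (cos b) by ring.
    apply atan_tan; lra. }
  assert (K := curve_length_bounds
    (short_arc O 1 (circle_point O u v a) (circle_point O u v b)) (chord_angle a b) 0 1).
  rewrite !short_arc_circle_point, E0, E1 in K by (trivial; lra).
  apply K; [lra|].
  intros s t Hs Hst Ht.
  rewrite !short_arc_circle_point by (trivial; lra).
  apply dist2_circle_point; [exact H|].
  apply chord_angle_incr; lra.
Qed.

(** * Half-chords *)

(** By Pythagoras, the foot of the perpendicular is the nearest point. *)
Lemma foot_nearest (X Y Z F P : C) : is_foot X Y Z F -> on_line Y Z P ->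
  dist2 X F <= dist2 X P.
Proof.
  intros [[s ->] Hdot] [t ->]; unfold dist2; rewrite !Cmod_dot.
  set (w := (Y + RtoC s * (Z - Y) - X)%C) in *.
  replace (Y + RtoC t * (Z - Y) - X)%C with (w + RtoC (t - s) * (Z - Y))%C
    by (unfold w; rewrite RtoC_minus; ring).
  apply sqrt_le_1_alt.
  generalize (Z - Y)%C, w, Hdot; clear; intros d w Hdot.
  assert (E : dot (w + RtoC (t - s) * d) (w + RtoC (t - s) * d)%C =
    dot w w + 2 * (t - s) * dot w d + (t - s) * (t - s) * dot d d)
    by (unfold dot; destruct w, d; simpl; ring).
  rewrite E, Hdot.
  assert (K := dot_self_ge0 d).
  assert (0 <= (t - s) * (t - s) * dot d d)
    by (apply Rmult_le_pos; [exact (Rle_0_sqr (t - s)) | exact K]).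
  lra.
Qed.

(** The distance from the point at angle [atan x] to the line of slope [y] through
    [O] is [(y - x) / (sqrt (1 + x^2) * sqrt (1 + y^2))], and
    [1 + x^2 <= 1 + y^2]. *)
Lemma foot_distance_ge (O u v F : C) (x y : R) : orthonormal u v ->
  0 <= x -> x <= y ->
  is_foot (circle_point O u v (atan x)) O (O + (u + RtoC y * v))%C F ->
  (y - x) / (1 + y * y) <= dist2 (circle_point O u v (atan x)) F.
Proof.
  intros H Hx Hxy [[s ->] Hdot].
  unfold dist2.
  set (p := s - cos (atan x)); set (q := s * y - sin (atan x)).
  assert (E : (O + RtoC s * (O + (u + RtoC y * v) - O) - circle_point O u v (atan x))%C
     = (RtoC p * u + RtoC q * v)%C)
    by (unfold circle_point, p, q; rewrite !RtoC_minus, RtoC_mult; ring).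
  rewrite E in Hdot |- *.
  replace (O + (u + RtoC y * v) - O)%C with (RtoC 1 * u + RtoC y * v)%C in Hdot by ring.
  rewrite dot_frame in Hdot by exact H.
  rewrite Cmod_frame by exact H.
  assert (Hn : 0 < sqrt (1 + x * x)) by (apply sqrt_lt_R0; nra).
  set (w := sqrt (1 + x * x)) in *.
  assert (Hw : w * w = 1 + x * x) by (apply sqrt_sqrt; nra).
  (* [q - p y] is the cross product of the direction [(1, y)] of the line with the
     vector [(p, q)] to the foot: it does not depend on the position [s] of the foot. *)
  assert (Hq : q * (1 + y * y) = (y - x) / w).
  { replace (q * (1 + y * y)) with (q - p * y + y * (p * 1 + q * y)) by ring.
    rewrite Hdot; unfold p, q; rewrite cos_atan, sin_atan.
    replace (1 + x²) with (1 + x * x) by (unfold Rsqr; ring); fold w; field; lra. }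
  assert (Hp : p = - (q * y)) by lra.
  assert (Hy : 0 < 1 + y * y) by nra.
  apply Rsqr_incr_0_var; [|apply sqrt_pos].
  rewrite Rsqr_sqrt by nra.
  replace (p * p + q * q) with (((q * (1 + y * y)) * (q * (1 + y * y))) / (1 + y * y))
    by (rewrite Hp; field; lra).
  rewrite Hq.
  replace (((y - x) / (1 + y * y))²) with ((y - x) * (y - x) / (1 + y * y) * / (1 + y * y))
    by (unfold Rsqr; field; lra).
  replace ((y - x) / w * ((y - x) / w) / (1 + y * y))
    with ((y - x) * (y - x) / (1 + y * y) * / (w * w)) by (field; lra).
  apply Rmult_le_compat_l; [apply Rdiv_le_0_compat; nra|].
  rewrite Hw; apply Rinv_le_contravar; nra.
Qed.

(** * Comparison of the sums *)

Lemma atan_increment_le (x y : R) : 0 <= x -> x <= y ->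
  atan y - atan x <= (y - x) / (1 + x * x).
Proof.
  intros Hx Hxy.
  destruct (MVT_gen atan x y (fun z => / (1 + z ^ 2))) as (z & Hz & E).
  - intros z _; apply is_derive_Reals.
    apply derivable_pt_lim_atan.
  - intros z _. apply derivable_continuous_pt, derivable_pt_atan.
  - rewrite Rmin_left, Rmax_right in Hz by lra.
    rewrite E, Rmult_comm; unfold Rdiv.
    apply Rmult_le_compat_l; [lra|].
    apply Rinv_le_contravar; nra.
Qed.

Theorem lemma1 (pO pE pA pS : C) (Cp Q : nat -> nat -> C)
  (Hsquare : is_square 1 pO pE pA pS)
  (HCp : forall n i : nat, (1 <= n)%nat -> (i <= n)%nat ->
    on_segment pO (division_point pE pA n i) (Cp n i) /\
    on_circle pO 1 (Cp n i))
  (HQ : forall n i : nat, (1 <= n)%nat -> (i < n)%nat ->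
    is_foot (Cp n i) pO (division_point pE pA n (i + 1)) (Q n i)) :
  let b := fun n i : nat => dist2 (Cp n i) (Q n i) in
  let c := fun n i : nat => short_arc_length pO 1 (Cp n i) (Cp n (i + 1)%nat) in
  exists Ahat Carc : R,
    is_lim_seq (fun n : nat => sum_n (b n) (n - 1)) Ahat /\
    is_lim_seq (fun n : nat => sum_n (c n) (n - 1)) Carc /\
    Carc = Ahat.
Proof.
  intros b c.
  set (u := (pE - pO)%C); set (v := (pA - pE)%C).
  assert (Huv : orthonormal u v) by exact (square_frame _ _ _ _ Hsquare).
  assert (Hdiv : forall n i, division_point pE pA n i =
    (pO + (u + RtoC (INR i / INR n) * v))%C)
    by (intros n i; unfold division_point, u, v; ring).
  assert (HC : forall n i, (1 <= n)%nat -> (i <= n)%nat ->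
    Cp n i = circle_point pO u v (atan (INR i / INR n))).
  { intros n i Hn Hi; destruct (HCp n i Hn Hi) as [H1 H2].
    rewrite Hdiv in H1; now apply radial_point. }
  set (x := fun n i => INR i / INR n).
  (* [(1/n) / (1 + x_{i+1}^2)], a lower bound for [b n i], is at least the increment
     of [G n], since the increment of [atan] is at most [(1/n) / (1 + x_i^2)]; so the
     lower bound for the sum of the [b n i] telescopes. *)
  set (G := fun n i => atan (x n i) + / INR n * / (1 + x n i * x n i)).
  assert (Hstep : forall n i, (1 <= n)%nat -> (i < n)%nat ->
    G n (S i) - G n i <= b n i /\
    b n i <= c n i <= atan (x n (S i)) - atan (x n i)).
  { intros n i Hn Hi.
    assert (Hn0 : 0 < INR n) by (apply lt_0_INR; lia).
    assert (Hx0 : 0 <= x n i)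
      by (apply Rdiv_le_0_compat; [apply pos_INR | exact Hn0]).
    assert (Hxd : x n (S i) - x n i = / INR n)
      by (unfold x; rewrite S_INR; field; lra).
    assert (Hinv : 0 < / INR n) by now apply Rinv_0_lt_compat.
    assert (Hx1 : x n i <= x n (S i)) by lra.
    assert (Hfoot := HQ n i Hn Hi).
    rewrite Hdiv in Hfoot; unfold b, c.
    rewrite Nat.add_1_r in *.
    rewrite !HC in * by lia; fold (x n i) (x n (S i)) in *.
    assert (B1 := atan_bound (x n i)); assert (B2 := atan_bound (x n (S i))).
    assert (Hatan : atan (x n i) <= atan (x n (S i)))
      by (left; apply atan_increasing; lra).
    destruct (short_arc_length_bounds pO u v _ _ Huv (proj1 B1) Hatan (proj2 B2))
      as [Hlo Hhi].
    assert (Hb := foot_distance_ge _ _ _ _ _ _ Huv Hx0 Hx1 Hfoot).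
    assert (Hd := atan_increment_le _ _ Hx0 Hx1).
    rewrite Hxd in Hb, Hd; unfold Rdiv in Hb, Hd.
    repeat split; [unfold G; lra | | exact Hhi].
    eapply Rle_trans; [|exact Hlo].
    apply foot_nearest with (1 := Hfoot), radial_point_on_line. }
  assert (Hsum : forall n, (1 <= n)%nat ->
    atan 1 - / INR n / 2 <= sum_n (b n) (n - 1) /\
    sum_n (b n) (n - 1) <= sum_n (c n) (n - 1) <= atan 1).
  { intros n Hn.
    assert (Hn0 : 0 < INR n) by (apply lt_0_INR; lia).
    assert (X0 : x n 0%nat = 0) by (unfold x; simpl; field; lra).
    assert (X1 : x n (S (n - 1)) = 1)
      by (replace (S (n - 1)) with n by lia; unfold x; field; lra).
    repeat split.
    - apply Rle_trans with (sum_n (fun i => G n (S i) - G n i) (n - 1)).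
      + rewrite sum_n_telescope; unfold G; rewrite X0, X1, atan_0.
        right; field; lra.
      + apply sum_n_le_upto; intros i Hi; apply Hstep; lia.
    - apply sum_n_le_upto; intros i Hi; apply Hstep; lia.
    - apply Rle_trans with (sum_n (fun i => atan (x n (S i)) - atan (x n i)) (n - 1)).
      + apply sum_n_le_upto; intros i Hi; apply Hstep; lia.
      + rewrite (sum_n_telescope (fun i => atan (x n i))), X0, X1, atan_0; lra. }
  assert (Hlim : is_lim_seq (fun n => atan 1 - / INR n / 2) (atan 1)).
  { replace (Finite (atan 1)) with (Finite (atan 1 - 0 * / 2)) by (f_equal; ring).
    apply is_lim_seq_minus'; [apply is_lim_seq_const|].
    apply (is_lim_seq_scal_r (fun n => / INR n) (/ 2) 0).
    apply (is_lim_seq_inv _ p_infty is_lim_seq_INR); discriminate. }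
  exists (atan 1), (atan 1); split; [|split; [|reflexivity]].
  - apply is_lim_seq_le_le_loc with (2 := Hlim) (3 := is_lim_seq_const _).
    exists 1%nat; intros n Hn; destruct (Hsum n Hn); lra.
  - apply is_lim_seq_le_le_loc with (2 := Hlim) (3 := is_lim_seq_const _).
    exists 1%nat; intros n Hn; destruct (Hsum n Hn); lra.
Qed.
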